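(* Let $G=(S,B,E)$ be an instance of the Online Bipartite Matching Problem which admits a matching of size $n$. Then for any $\alpha>0$ and any arrival order of the buyers, \[ \mathbb{P}\left[|M| < \left(1-\frac{1}{e}-\alpha\right)n\right] < e^{-2\alpha^2 n}, \] where $M$ is the random variable denoting the matching generated by \textsc{Ranking}.
   Context: Online Bipartite Matching Problem: $G=(S,B,E)$ is an undirected bipartite graph with a set $S$ of sellers (known in advance) and a set $B$ of buyers. The buyers arrive one at a time in an adversarially chosen order; when a buyer $i$ arrives, its neighborhood $N(i)\subseteq S$ is revealed, and the algorithm must irrevocably decide to match $i$ to a currently unmatched neighbor or leave it unmatched. \textsc{Ranking}: for every $j\in S$, independently sample a uniformly random rank $x_j\in[0,1]$ (before any buyer arrives); when buyer $i$ arrives, match $i$ to the unmatched $j\in N(i)$ with minimum $x_j$ (if any unmatched neighbor exists; ties occur with probability zero). $|M|$ is the number of edges of the resulting matching. *)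

(* Defs.v *)
From HB Require Import structures.
From mathcomp Require Import all_boot all_order all_algebra.
From mathcomp Require Import all_classical all_reals all_analysis.

Set Implicit Arguments.
Unset Strict Implicit.
Unset Printing Implicit Defensive.

Import Order.TTheory GRing.Theory Num.Theory.

Local Open Scope classical_set_scope.
Local Open Scope ring_scope.

(* ---------- Bipartite graphs and matchings ----------
   Sellers form a finite type S, buyers a finite type B, and the edge set E
   of G = (S, B, E) is given by the adjacency relation [adj i j] meaning
   that buyer i and seller j are adjacent; N(i) = [set j | adj i j]. *)

Section Graph.
Variables (S B : finType) (adj : B -> S -> bool).

Definition is_matching (M : {set B * S}) : Prop :=
  (forall e, e \in M -> adj e.1 e.2) /\
  (forall e f, e \in M -> f \in M -> (e.1 == f.1) || (e.2 == f.2) -> e = f).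

Definition admits_matching_of_size (n : nat) : Prop :=
  exists M : {set B * S}, is_matching M /\ #|M| = n.

Definition arrival_order (ord : seq B) : Prop := perm_eq ord (enum B).

(* ---------- The RANKING algorithm ----------
   Given the ranks x : S -> R, buyers are processed in the arrival order;
   [matched] is the set of sellers already matched.  An arriving buyer i is
   matched to the unmatched neighbour of minimum rank, if any.  (Ties have
   probability zero; they are broken by Order.arg_min deterministically.) *)
Variable (R : realType).

Fixpoint ranking_aux (x : S -> R) (ord : seq B) (matched : {set S})
  : seq (B * S) :=
  match ord with
  | [::] => [::]
  | i :: rest =>
      let A := [set j | adj i j & j \notin matched] in
      match [pick j in A] with
      | Some j0 =>
          let j := Order.arg_min j0 (fun j => j \in A) x in
          (i, j) :: ranking_aux x rest (j |: matched)
      | None => ranking_aux x rest matched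
      end
  end.

Definition ranking (x : S -> R) (ord : seq B) : seq (B * S) :=
  ranking_aux x ord (finset.set0 : {set S}).

Definition ranking_size (x : S -> R) (ord : seq B) : nat :=
  size (ranking x ord).

End Graph.

Section Ranks.
Context {R : realType} {d : measure_display} {T : measurableType d}.
Variables (S : finType) (P : probability T R) (x : S -> T -> R).

Definition ranks_measurable : Prop :=
  forall j, measurable_fun setT (x j).

Definition ranks_uniform01 : Prop :=
  forall j (A : set R), measurable A ->
    P (x j @^-1` A) = (@lebesgue_measure R) (A `&` `[0%R, 1%R]).

Definition ranks_independent : Prop :=
  forall (J : {set S}) (A : S -> set R), (forall j, measurable (A j)) ->
    P (\big[setI/setT]_(j in J) (x j @^-1` A j)) =
    (\big[*%E/1%E]_(j in J) P (x j @^-1` A j))%E.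

End Ranks.

(* Main.v *)
(** Discretise the ranks to [floor (N x_j)], independent and uniform on
    [{0, ..., N - 1}]; off a collision event of probability at most [|S|^2 / N]
    the discrete ranks induce the same run.  Fix a matching with [n] edges and
    average only over the ranks of its [n] sellers, the others being arbitrary.
    Deleting a seller changes the size of the output by at most one, so
    Hoeffding's lemma applied to these sellers one at a time gives a
    sub-Gaussian bound with variance proxy [n / 4].  The randomised primal-dual
    argument (a matched edge pays [weight (v j)] to its seller [j] and the rest
    to its buyer) shows that this partial average is at least
    [(1 - (1 + 1/N)^(-N)) n] for every choice of the remaining ranks.  Since [|M|]
    is an integer, the event is one of deviation [beta > alpha], and this slack
    absorbs the discretisation errors for [N] large. *)

Require Import Defs.
From HB Require Import structures.
From mathcomp Require Import all_boot all_order all_algebra.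
From mathcomp Require Import all_classical all_reals all_analysis.
From mathcomp Require Import ring lra.
Import Order.TTheory GRing.Theory Num.Theory.
Local Open Scope classical_set_scope.
Local Open Scope ring_scope.

Set Implicit Arguments.
Unset Strict Implicit.
Unset Printing Implicit Defensive.

(** * Deletion of a seller in RANKING *)

Section Greedy.
Context {S B : finType} (adj : B -> S -> bool) {R : realType}.
Implicit Types (x y : S -> R) (F A : {set S}) (ord : seq B) (i : B) (j k : S).

(** The choice made by [Order.arg_min], without its default element: it depends only on [F] and on
    the comparisons of [x] over [F], ties included. *)
Definition first_min x F : option S :=
  [pick j in F | [forall k in F, x j <= x k]].

Definition free i A : {set S} := [set j | adj i j & j \notin A].

(** [pick] returns the head of the filtered enumeration, and filtering by [q] factors through
    filtering by [p], so a head satisfying [q] survives. This keeps tie-breaking stable when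
    candidates are removed. *)
Lemma pick_sub (I : finType) (p q : pred I) (i : I) :
  {subset q <= p} -> q i -> pick p = Some i -> pick q = Some i.
Proof.
move=> qp qi; rewrite /pick /enum_mem => Hp.
have -> : seq.filter (mem q) (Finite.enum I) =
    seq.filter (mem q) (seq.filter (mem p) (Finite.enum I)).
  rewrite -filter_predI; apply: eq_filter => z /=.
  by rewrite andbC; apply/idP/andP => [zq|[]//]; split=> //; apply: qp.
case: (seq.filter (mem p) _) Hp => //= a s [->].
by rewrite /= /in_mem /= qi.
Qed.

Lemma ranking_aux_cons x i ord A :
  ranking_aux adj x (i :: ord) A =
  if first_min x (free i A) is Some j
  then (i, j) :: ranking_aux adj x ord (j |: A) else ranking_aux adj x ord A.
Proof.
rewrite /= -/(free i A) /first_min.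
case: pickP => [j0 j0F|F0].
  (* [Order.arg_min] is a [pick] with default [j0]; a minimiser exists, so the default is never
     returned. *)
  rewrite /Order.arg_min /extremum /=.
  rewrite (_ : pick _ = [pick j in free i A | [forall k in free i A, x j <= x k]])//.
  case: pickP => //= noMin.
  case: (@Order.TotalTheory.arg_minP _ _ _ j0 (mem (free i A)) x j0F) => j jF jmin.
  have /negP[] := negbT (noMin j); apply/andP; split; first exact: jF.
  by apply/forall_inP => k kF; exact: jmin.
by case: pickP => // j /andP[jF _]; move: (F0 j); rewrite jF.
Qed.

Variant first_min_spec x F : option S -> Type :=
  | FirstMinSome j of j \in F & {in F, forall k, x j <= x k} :
      first_min_spec x F (Some j)
  | FirstMinNone of F = finset.set0 : first_min_spec x F None.

Lemma first_minP x F : first_min_spec x F (first_min x F).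
Proof.
rewrite /first_min; case: pickP => [j /andP[jF /forall_inP jmin]|noMin].
  by constructor.
constructor; apply/eqP; apply: contraT => /set0Pn[j0 j0F].
case: (@Order.TotalTheory.arg_minP _ _ _ j0 (mem F) x j0F) => j jF jmin.
have /negP[] := negbT (noMin j); apply/andP; split; first exact: jF.
by apply/forall_inP => k kF; exact: jmin.
Qed.

Lemma first_min_sub x F F' j : F' \subset F -> j \in F' ->
  first_min x F = Some j -> first_min x F' = Some j.
Proof.
move=> /fintype.subsetP sF jF' xFj.
have jmin : {in F, forall k, x j <= x k}.
  by case: first_minP xFj => // ? _ jmin [<-].
pose minp (G : {set S}) j := (j \in G) && [forall k in G, x j <= x k].
apply: (@pick_sub S (minp F) (minp F') j _ _ xFj) => [k /andP[kF' /forall_inP kmin]|].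
  apply/andP; split; first exact: sF.
  by apply/forall_inP => l lF; apply: le_trans (kmin _ jF') (jmin _ lF).
by rewrite /minp jF'; apply/forall_inP => k /sF; exact: jmin.
Qed.

Lemma first_min_cmp x y F :
  {in F &, forall j k, (x j <= x k) = (y j <= y k)} ->
  first_min x F = first_min y F.
Proof.
move=> xy; apply: eq_pick => j /=; case jF: (j \in F) => //=.
by apply: eq_forallb_in => k kF; rewrite xy.
Qed.

Lemma free_setU1 i j A : free i (j |: A) = free i A :\ j.
Proof. by apply/setP => k; rewrite !inE negb_or; case: (adj i k); case: eqP. Qed.

(** The run sees ranks only through comparisons of unmatched sellers. Hence the rank of a deleted
    seller is irrelevant, the events of interest are measurable, and discrete ranks can replace
    continuous ones. *)
Lemma ranking_aux_cmp x y ord A :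
  {in [pred j | j \notin A] &, forall j k, (x j <= x k) = (y j <= y k)} ->
  ranking_aux adj x ord A = ranking_aux adj y ord A.
Proof.
elim: ord A => // i ord IH A xy.
rewrite !ranking_aux_cons (@first_min_cmp x y); last first.
  by move=> j k; rewrite !inE => /andP[_ jA] /andP[_ kA]; apply: xy.
case: first_minP => [j _ _|_]; last exact: IH.
rewrite IH// => k l; rewrite !inE !negb_or => /andP[_ kA] /andP[_ lA].
exact: xy.
Qed.

Lemma ranking_aux_notin x ord A e :
  e \in ranking_aux adj x ord A -> e.2 \notin A.
Proof.
elim: ord A => // i ord IH A; rewrite ranking_aux_cons.
case: first_minP => [j|_]; last exact: IH.
rewrite !inE => /andP[_ jA] _ /predU1P[->//|/IH].
by rewrite !inE negb_or => /andP[].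
Qed.

(* Deleting the seller [j] is modelled by starting with [j] already matched. *)
Lemma size_ranking_aux_setU1 x ord j A : j \notin A ->
  (size (ranking_aux adj x ord (j |: A)) <= size (ranking_aux adj x ord A)
    <= (size (ranking_aux adj x ord (j |: A))).+1)%N.
Proof.
elim: ord j A => [|i ord IH] j A jA //; rewrite !ranking_aux_cons free_setU1.
case E: (first_min x (free i A)) => [k|].
  (* If the full run takes [j], the deleted run either takes some [l], which becomes the one extra
     deleted seller, or takes nothing, and the runs coincide from then on. *)
  case: (eqVneq k j) => [kj|kj].
    rewrite kj; case: (first_minP x (free i A :\ j)) => [l|_] /=.
      rewrite !inE => /and3P[lj _ lA] _.
      have /andP[] : (size (ranking_aux adj x ord (l |: (j |: A)))
          <= size (ranking_aux adj x ord (j |: A))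
          <= (size (ranking_aux adj x ord (l |: (j |: A)))).+1)%N.
        by apply: IH; rewrite !inE negb_or lj.
      by move=> h1 h2; rewrite !ltnS h1 h2.
    by rewrite leqnSn ltnS leqnn.
  have kF : k \in free i A by case: first_minP E => // ? ? _ [<-].
  have kF' : k \in free i A :\ j by rewrite in_setD1 kj.
  rewrite (first_min_sub (subD1set _ _) kF' E) /=.
  by rewrite finset.setUCA !ltnS; apply: IH; rewrite !inE negb_or eq_sym kj.
have -> : free i A = finset.set0 by case: first_minP E => [? ? ? []|].
rewrite finset.set0D; case: first_minP => [l|_]; first by rewrite inE.
exact: IH.
Qed.

(** At every moment the full run has at most one more free seller than the deleted run and lacks
    none, so each buyer chooses from a larger set. *)
Lemma ranking_aux_setU1_le x ord j A i k : j \notin A ->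
  (i, k) \in ranking_aux adj x ord (j |: A) ->
  exists2 l, (i, l) \in ranking_aux adj x ord A & x l <= x k.
Proof.
elim: ord j A => [|b ord IH] j A jA //; rewrite !ranking_aux_cons free_setU1.
case E: (first_min x (free b A)) => [m|].
  have [mF mmin] : m \in free b A /\ {in free b A, forall k, x m <= x k}.
    by case: first_minP E => // ? ? ? [<-].
  case: (eqVneq m j) => [mj|mj].
    rewrite mj; case: (first_minP x (free b A :\ j)) => [l|_] /=.
      move=> /[dup] lFj; rewrite !inE => /and3P[lj bl lA] _.
      case/predU1P => [[-> ->]|/IH[]].
      - exists j; first exact: mem_head.
        by rewrite -mj; apply: mmin; rewrite !inE bl lA.
      - by rewrite !inE negb_or lj.
      - by move=> h hin hk; exists h => //; rewrite inE hin orbT.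
    by move=> ik; exists k => //; rewrite inE ik orbT.
  have mF' : m \in free b A :\ j by rewrite in_setD1 mj.
  rewrite (first_min_sub (subD1set _ _) mF' E) /=.
  case/predU1P => [[-> ->]|]; first by exists m; rewrite ?mem_head.
  rewrite finset.setUCA => /IH[]; first by rewrite !inE negb_or eq_sym mj.
  by move=> h hin hk; exists h => //; rewrite inE hin orbT.
have -> : free b A = finset.set0 by case: first_minP E => [? ? ? []|].
rewrite finset.set0D; case: first_minP => [l|_]; first by rewrite inE.
exact: IH.
Qed.

Lemma ranking_aux_unmatched x ord j A : j \notin A ->
  (forall e, e \in ranking_aux adj x ord A -> e.2 != j) ->
  ranking_aux adj x ord (j |: A) = ranking_aux adj x ord A.
Proof.
elim: ord A => [|b ord IH] A jA //; rewrite !ranking_aux_cons free_setU1.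
case E: (first_min x (free b A)) => [m|].
  move=> nj; have mj : m != j by apply: (nj (b, m)); rewrite mem_head.
  have mF : m \in free b A by case: first_minP E => // ? ? _ [<-].
  have mF' : m \in free b A :\ j by rewrite in_setD1 mj.
  rewrite (first_min_sub (subD1set _ _) mF' E) /=.
  rewrite finset.setUCA IH// => [|e eM]; last by apply: nj; rewrite inE eM orbT.
  by rewrite !inE negb_or eq_sym mj.
have -> : free b A = finset.set0 by case: first_minP E => [? ? ? []|].
rewrite finset.set0D; case: first_minP => [l|_]; first by rewrite inE.
exact: IH.
Qed.

(** Seller [j] is still free when [i] arrives, so [i] has a candidate and takes one ranked no higher
    than [j]. *)
Lemma ranking_aux_adj x ord i j A : j \notin A -> adj i j -> i \in ord ->
  (forall e, e \in ranking_aux adj x ord A -> e.2 != j) ->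
  exists2 k, (i, k) \in ranking_aux adj x ord A & x k <= x j.
Proof.
elim: ord A => [|b ord IH] A jA // ij; rewrite ranking_aux_cons inE.
case: first_minP => [m mF mmin|F0] ib nj.
  have [ib'|nib] := eqVneq i b.
    exists m; first by rewrite ib' mem_head.
    by apply: mmin; rewrite inE -ib' ij jA.
  rewrite (negbTE nib) /= in ib.
  have mj : m != j by apply: (nj (b, m)); rewrite mem_head.
  have [|e eM|k kin xk] := IH (m |: A) _ ij ib.
  - by rewrite !inE negb_or eq_sym mj.
  - by apply: nj; rewrite inE eM orbT.
  - by exists k => //; rewrite inE kin orbT.
case/predU1P: ib => [ib|ib]; last exact: IH.
have : j \in free b A by rewrite inE -ib ij jA.
by rewrite F0 inE.
Qed.

End Greedy.

(** * Averages over single coordinates *)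

Section Averaging.
Context {S K : finType} {R : realType}.
Local Notation V := {ffun S -> K}.
Implicit Types (f g : V -> R) (v : V) (i j : S) (a b : K) (J : seq S).

Definition upd v j a : V := [ffun k => if k == j then a else v k].

Lemma upd_same v j a b : upd (upd v j a) j b = upd v j b.
Proof. by apply/ffunP => k; rewrite !ffunE; case: eqP. Qed.

Lemma upd_id v j : upd v j (v j) = v.
Proof. by apply/ffunP => k; rewrite ffunE; case: eqP => [->|]. Qed.

Lemma upd_comm v i j a b : i != j -> upd (upd v i a) j b = upd (upd v j b) i a.
Proof.
move=> ij; apply/ffunP => k; rewrite !ffunE; case: eqP => // ->.
by rewrite eq_sym (negbTE ij).
Qed.

(** The average remains a function on all of [V], constant in coordinate [j], so that averages over
    several coordinates can be iterated. *)
Definition avg j f v : R := (\sum_a f (upd v j a)) / #|K|%:R.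

Definition avgs J f : V -> R := foldr avg f J.

Definition mean f : R := (\sum_v f v) / #|V|%:R.

Hypothesis K0 : (0 < #|K|)%N.

Let K0R : 0 < #|K|%:R :> R. Proof. by rewrite ltr0n. Qed.

Lemma ler_avg j f g v : (forall a, f (upd v j a) <= g (upd v j a)) ->
  avg j f v <= avg j g v.
Proof.
by move=> fg; rewrite /avg ler_pM2r ?invr_gt0//; apply: ler_sum => a _.
Qed.

Lemma avg_cst j (c : R) v : avg j (fun=> c) v = c.
Proof.
by rewrite /avg sumr_const -(mulr_natr c) mulfK ?gt_eqF.
Qed.

Lemma avgZl j (c : R) f v : avg j (fun v => c * f v) v = c * avg j f v.
Proof. by rewrite /avg -mulr_sumr mulrA. Qed.

Lemma avg_affine j (b c : R) f v :
  avg j (fun v => b + c * f v) v = b + c * avg j f v.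
Proof.
by rewrite -avgZl -[in RHS](avg_cst j b v) /avg -mulrDl -big_split.
Qed.

Lemma avg_comm i j f : avg i (avg j f) = avg j (avg i f).
Proof.
have [->//|ij] := eqVneq i j; apply/funext => v.
rewrite /avg -!mulr_suml exchange_big /=; congr (_ / _ / _).
apply: eq_bigr => a _; apply: eq_bigr => b _.
by rewrite upd_comm.
Qed.

Lemma avg_avgs j J f : avg j (avgs J f) = avgs J (avg j f).
Proof. by elim: J => //= k J IH; rewrite avg_comm IH. Qed.

Lemma ler_avgs J f g : (forall v, f v <= g v) -> forall v, avgs J f v <= avgs J g v.
Proof. by move=> fg; elim: J => //= j J IH v; apply: ler_avg. Qed.

Lemma avgs_cst J (c : R) : avgs J (fun=> c) = fun=> c.
Proof. by elim: J => //= j J ->; apply/funext => v; rewrite avg_cst. Qed.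

(** Averages over coordinates commute, so the one over [j] can be taken first; its bound is uniform
    in [v] and the other averages preserve it. *)
Lemma avgs_ge J j f (c : R) : j \in J -> (forall v, c <= avg j f v) ->
  forall v, c <= avgs J f v.
Proof.
elim: J => // k J IH; rewrite inE => jkJ cf v /=.
rewrite -[leLHS](avg_cst k c v).
case/predU1P: jkJ => [<-|jJ]; last by apply: ler_avg => a; exact: IH.
by rewrite avg_cst avg_avgs; have := @ler_avgs J _ _ cf v; rewrite avgs_cst.
Qed.

Lemma avgs_sum J (I : Type) (r : seq I) (p : pred I) (F : I -> V -> R) v :
  avgs J (fun v => \sum_(i <- r | p i) F i v) v =
  \sum_(i <- r | p i) avgs J (F i) v.
Proof.
elim: J v => //= j J IH v; rewrite /avg -mulr_suml exchange_big /=.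
by congr (_ / _); apply: eq_bigr => a _; rewrite IH.
Qed.

Lemma ler_mean f g : (forall v, f v <= g v) -> mean f <= mean g.
Proof.
by move=> fg; rewrite /mean ler_wpM2r ?invr_ge0//; apply: ler_sum => v _.
Qed.

Lemma mean_cst (c : R) : mean (fun=> c) = c.
Proof.
rewrite /mean sumr_const -(mulr_natr c) mulfK// pnatr_eq0 -lt0n card_ffun.
by rewrite expn_gt0 K0.
Qed.

Lemma meanZl (c : R) f : mean (fun v => c * f v) = c * mean f.
Proof. by rewrite /mean -mulr_sumr mulrA. Qed.

Lemma mean_sum (I : Type) (r : seq I) (p : pred I) (F : I -> V -> R) :
  mean (fun v => \sum_(i <- r | p i) F i v) = \sum_(i <- r | p i) mean (F i).
Proof. by rewrite /mean exchange_big /= mulr_suml. Qed.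

Lemma mean_avg j f : mean (avg j f) = mean f.
Proof.
rewrite /mean /avg -mulr_suml; congr (_ / _).
(* Swapping the [j]-th coordinate with the averaged value is an involution. *)
rewrite pair_big /= (reindex_inj (h := fun p : V * K => (upd p.1 j p.2, p.1 j))).
  rewrite -(pair_big xpredT xpredT (fun (v : V) (a : K) => f (upd (upd v j a) j (v j)))) /=.
  under eq_bigr do under eq_bigr do rewrite upd_same upd_id.
  under eq_bigr do rewrite sumr_const -mulr_natr.
  by rewrite -mulr_suml mulfK ?gt_eqF.
apply: (can_inj (g := fun p : V * K => (upd p.1 j p.2, p.1 j))) => -[v a] /=.
by rewrite upd_same upd_id ffunE eqxx.
Qed.

Lemma mean_avgs J f : mean (avgs J f) = mean f.
Proof. by elim: J => //= j J IH; rewrite mean_avg. Qed.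

Definition oscillates1 j f := forall v a b, f (upd v j a) - f (upd v j b) <= 1.

Lemma oscillates1_avg i j f : oscillates1 j f -> oscillates1 j (avg i f).
Proof.
move=> fj v a b; rewrite /avg -mulrBl ler_pdivrMr// mul1r -sumrB.
have [->|ij] := eqVneq i j.
  by under eq_bigr do rewrite !upd_same subrr; rewrite big1.
rewrite -[#|K|%:R](sumr_const K 1); apply: ler_sum => c _.
by rewrite -!(upd_comm _ _ _ ij).
Qed.

Lemma oscillates1_avgs J j f : oscillates1 j f -> oscillates1 j (avgs J f).
Proof. by move=> fj; elim: J => //= i J IH; apply: oscillates1_avg. Qed.

End Averaging.

(** * Hoeffding's lemma and McDiarmid's inequality *)

Section Hoeffding.
Context {R : realType}.
Implicit Types p s t : R.

Lemma ge0_derive_le (f df : R -> R) s : 0 <= s ->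
  (forall t, is_derive t 1 f (df t)) -> (forall t, 0 <= t -> 0 <= df t) ->
  f 0 <= f s.
Proof.
move=> s0 fd df0.
have [|c cs fE] := @MVT_segment R f df 0 s s0 (fun t _ => fd t).
  by apply: derivable_within_continuous => t _; exact: ex_derive.
rewrite -subr_ge0 fE subr0 mulr_ge0// df0//.
by move: cs; rewrite in_itv /= => /andP[].
Qed.

Lemma expR_chord s t : 0 <= t <= 1 -> expR (s * t) <= 1 - t + t * expR s.
Proof.
move=> t01.
have := @convex_expR R (Itv01 (proj1 (andP t01)) (proj2 (andP t01))) s 0.
rewrite !convRE /= expR0.
by rewrite mulr0 addr0 mulr1 (mulrC t s) addrC.
Qed.

Lemma bernoulli_mgf_gt0 p s : 0 <= p <= 1 -> 0 < 1 - p + p * expR s.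
Proof.
move=> /andP[p0 p1]; have e0 := expR_gt0 s.
have [->|p1'] := eqVneq p 1; first by rewrite subrr add0r mul1r.
apply: ltr_pwDl; first by rewrite subr_gt0 lt_neqAle p1'.
by rewrite mulr_ge0// ltW.
Qed.

(** Hoeffding's lemma for a Bernoulli variable: the logarithm of [D], its moment generating
    function, has second derivative at most 1/4. Here [G] is the gap between the logarithms of the
    two sides, and [F] is its derivative. *)
Lemma bernoulli_mgf_le p s : 0 <= p <= 1 -> 0 <= s ->
  1 - p + p * expR s <= expR (s * p + s ^+ 2 / 8).
Proof.
move=> p01 s0.
have [D DE] : exists D : R -> R, forall t, D t = 1 - p + p * expR t by eexists.
have D0 t : 0 < D t by rewrite DE bernoulli_mgf_gt0.
have dD t : is_derive t 1 D (p * expR t).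
  have -> : D = fun t => 1 - p + p * expR t by apply/funext.
  by apply: is_derive_eq; rewrite add0r mul1r.
have dV t : is_derive t 1 (fun t => (D t)^-1) (- (p * expR t) / D t ^+ 2).
  apply: (is_derive_eq (is_deriveV (lt0r_neq0 (D0 t)) (dD t))).
  by rewrite /GRing.scale /= !mulNr mulrC.
have dl t : is_derive t 1 (fun t => ln (D t)) (p * expR t / D t).
  by apply: (is_derive_eq (is_derive1_comp (is_derive1_ln (D0 t)) (dD t))); rewrite mulrC.
(* [F] uses [p * expR t / D t = 1 - (1 - p) / D t], so that [t] enters the quotient only through
   [D]. *)
pose F := (fun t : R => p + t / 4 - 1) + (fun t => (1 - p) * (D t)^-1).
pose G := (fun t : R => t * p + t ^+ 2 / 8) - (fun t => ln (D t)).
have FE t : F t = p + t / 4 - 1 + (1 - p) * (D t)^-1 by [].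
have GE t : G t = t * p + t ^+ 2 / 8 - ln (D t) by [].
have F0 t : 0 <= t -> 0 <= F t.
  move=> t0; have <- : F 0 = 0.
    by rewrite FE DE expR0 mulr1 subrK invr1; ring.
  apply: (@ge0_derive_le F (fun t => 4^-1 - (1 - p) * (p * expR t) / D t ^+ 2)) => [//|u|u _].
    rewrite /F. apply: is_derive_eq.
    by rewrite /GRing.scale /= !mulr0 mulr1 !add0r mul1r subr0; ring.
  rewrite subr_ge0 ler_pdivrMr ?exprn_gt0//.
  (* AM-GM for the two summands [1 - p] and [p * expR u] of [D u]. *)
  rewrite DE; have := sqr_ge0 (1 - p - p * expR u); lra.
have : G 0 <= G s.
  apply: (@ge0_derive_le G F) => [//|t|//].
  rewrite /G. apply: is_derive_eq; rewrite FE /GRing.scale /=.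
  have -> : p * expR t = D t - (1 - p) by rewrite DE; ring.
  by field; rewrite lt0r_neq0.
rewrite !GE DE expR0 mulr1 subrK ln1 mul0r expr0n /= mul0r addr0 subr0.
by rewrite subr_ge0 -ler_expR lnK ?posrE// DE.
Qed.

End Hoeffding.

Section McDiarmid.
Context {S K : finType} {R : realType}.
Local Notation V := {ffun S -> K}.
Implicit Types (f : V -> R) (v : V) (j : S) (J : seq S).
Hypothesis K0 : (0 < #|K|)%N.

(** Along coordinate [j] the values of [f] fill at most a unit interval. Replacing the exponential
    by its chord there gives a function affine in [f], whose average is a Bernoulli moment
    generating function. *)
Lemma hoeffding_avg j f (s : R) v : oscillates1 j f -> 0 <= s ->
  avg j (fun v => expR (- s * f v)) v <= expR (- s * avg j f v + s ^+ 2 / 8).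
Proof.
move=> fj s0; have /card_gt0P[a1 _] := K0.
case: (@Order.TotalTheory.arg_minP _ _ _ a1 xpredT (fun a => f (upd v j a)) isT).
move=> a0 _ f_ge.
(* The reflection [t] of [f] turns the exponent [- s * f] into [s * t] up to a constant, matching
   the bounds stated for [0 <= s]. *)
pose c := f (upd v j a0); pose t u := c + 1 - f u.
have t01 a : 0 <= t (upd v j a) <= 1.
  by rewrite /t /c; have := f_ge a isT; have := fj v a a0; lra.
have tE u : 1 - t u + t u * expR s =
    (1 + (expR s - 1) * (c + 1)) + (1 - expR s) * f u by rewrite /t; ring.
pose T := c + 1 - avg j f v.
have T01 : 0 <= T <= 1.
  apply/andP; split.
    rewrite /T subr_ge0 -[leRHS](avg_cst K0 j (c + 1) v).
    apply: ler_avg => // a; have := t01 a; rewrite /t; lra.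
  rewrite /T lerBlDr addrC lerD2l -[leLHS](avg_cst K0 j c v).
  by apply: ler_avg => // a; have := t01 a; rewrite /t; lra.
have -> : - s * avg j f v + s ^+ 2 / 8 =
  - (s * (c + 1)) + (s * T + s ^+ 2 / 8) by rewrite /T; ring.
rewrite expRD.
apply: (le_trans _ (ler_wpM2l (expR_ge0 _) (bernoulli_mgf_le T01 s0))).
have -> : 1 - T + T * expR s =
    avg j (fun v => (1 + (expR s - 1) * (c + 1)) + (1 - expR s) * f v) v.
  by rewrite avg_affine// /T; ring.
rewrite -avgZl; apply: ler_avg => // a; rewrite -tE.
have -> : - s * f (upd v j a) = - (s * (c + 1)) + s * t (upd v j a).
  by rewrite /t; ring.
by rewrite expRD ler_wpM2l ?expR_ge0// expR_chord.
Qed.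

(** Coordinates are averaged one at a time; the partial averages still oscillate by at most one, so
    each step costs [s ^+ 2 / 8]. Coordinates outside [J] stay frozen at [v]. *)
Lemma mcdiarmid_avgs J f (s : R) : (forall j, j \in J -> oscillates1 j f) ->
  0 <= s -> forall v, avgs J (fun v => expR (- s * f v)) v <=
  expR (- s * avgs J f v + s ^+ 2 / 8 * (size J)%:R).
Proof.
move=> + s0; elim: J => [|j J IH] fJ v /=; first by rewrite mulr0 addr0.
have {}IH := IH (fun k kJ => fJ k (mem_behead (s := j :: J) kJ)).
pose h u := expR (s ^+ 2 / 8 * (size J)%:R) * expR (- s * avgs J f u).
apply: (@le_trans _ _ (avg j h v)).
  by apply: ler_avg => // a; rewrite /h -expRD addrC; exact: IH.
rewrite avgZl [leRHS](_ : _ = expR (s ^+ 2 / 8 * (size J)%:R) *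
    expR (- s * avg j (avgs J f) v + s ^+ 2 / 8)); last first.
  by rewrite -expRD -natr1; congr expR; ring.
rewrite ler_wpM2l ?expR_ge0//.
apply: hoeffding_avg => //; apply: oscillates1_avgs => //.
by apply: fJ; rewrite mem_head.
Qed.

End McDiarmid.

(** * RANKING with discrete ranks *)

Section DiscreteRanking.
Context {S B : finType} (adj : B -> S -> bool) {R : realType} (m : nat).
Variable ord : seq B.
Local Notation V := {ffun S -> 'I_m.+1}.
Implicit Types (v : V) (i : B) (j : S) (a : 'I_m.+1) (k : nat).

Definition rank_of v : S -> R := fun j => (v j)%:R.

Let K0 : (0 < #|'I_m.+1|)%N. Proof. by rewrite card_ord. Qed.

Definition matching_size v : R := (ranking_size adj (rank_of v) ord)%:R.

Lemma rank_of_upd v j a l : l != j -> rank_of (upd v j a) l = rank_of v l.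
Proof. by move=> lj; rewrite /rank_of ffunE (negbTE lj). Qed.

Lemma ranking_deleted_upd v j a :
  ranking_aux adj (rank_of (upd v j a)) ord [set j] =
  ranking_aux adj (rank_of v) ord [set j].
Proof.
by apply: ranking_aux_cmp => k l; rewrite !inE => kj lj; rewrite !rank_of_upd.
Qed.

(** The size [g] of the run without [j] does not depend on the rank of [j], and the full size is [g]
    or [g + 1]. *)
Lemma oscillates1_matching_size j : oscillates1 j matching_size.
Proof.
move=> v a b; pose g := size (ranking_aux adj (rank_of v) ord [set j]).
have bnd c : g%:R <= matching_size (upd v j c) <= g%:R + 1.
  have /andP[] := @size_ranking_aux_setU1 _ _ adj _ (rank_of (upd v j c)) ord j
    finset.set0 (negbT (finset.in_set0 j)).
  rewrite finset.setU0 ranking_deleted_upd -/g => h1 h2.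
  by rewrite natr1 /matching_size !ler_nat; apply/andP.
by have := bnd a; have := bnd b; lra.
Qed.

(* The discrete analogue of [expR (y - 1)]: the solution of
   [weight (y + 1) - weight y = weight y / N] and [weight N = 1], N = m + 1. *)
Definition weight k : R := (1 + m.+1%:R^-1) ^+ k / (1 + m.+1%:R^-1) ^+ m.+1.

Let N0 : 0 < m.+1%:R :> R. Proof. by rewrite ltr0n. Qed.

Let q0 : 0 < 1 + m.+1%:R^-1 :> R.
Proof. by rewrite addr_gt0// invr_gt0. Qed.

Lemma weight_ge0 k : 0 <= weight k.
Proof. by rewrite /weight divr_ge0 ?exprn_ge0// ltW. Qed.

Lemma weight_max : weight m.+1 = 1.
Proof. by rewrite /weight divff// expf_neq0// gt_eqF. Qed.

Lemma ler_weight k l : (k <= l)%N -> weight k <= weight l.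
Proof.
move=> kl; rewrite /weight ler_pM2r ?invr_gt0 ?exprn_gt0//.
by rewrite ler_weXn2l// lerDl invr_ge0 ltW.
Qed.

Lemma sum_weight k : (\sum_(l < k) weight l) / m.+1%:R = weight k - weight 0.
Proof.
elim: k => [|k IH]; first by rewrite big_ord0 mul0r subrr.
rewrite big_ord_recr mulrDl IH.
have -> : weight k.+1 = (1 + m.+1%:R^-1) * weight k by rewrite /weight exprS mulrA.
by rewrite /=; ring.
Qed.

Definition seller_gain j v : R :=
  \sum_(e <- ranking adj (rank_of v) ord | e.2 == j) weight (v e.2).

Definition buyer_gain i v : R :=
  \sum_(e <- ranking adj (rank_of v) ord | e.1 == i) (1 - weight (v e.2)).

Let weight_le1 a : 0 <= 1 - weight a.
Proof. by rewrite subr_ge0 -weight_max ler_weight// ltnW. Qed.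

Lemma seller_gain_ge0 j v : 0 <= seller_gain j v.
Proof. by apply: sumr_ge0 => e _; exact: weight_ge0. Qed.

Lemma buyer_gain_ge0 i v : 0 <= buyer_gain i v.
Proof. by apply: sumr_ge0 => e _. Qed.

Lemma sum_gains v :
  \sum_i buyer_gain i v + \sum_j seller_gain j v = matching_size v.
Proof.
rewrite /buyer_gain /seller_gain.
have sumE (I : finType) (p : B * S -> I) (F : B * S -> R) :
    \sum_i \sum_(e <- ranking adj (rank_of v) ord | p e == i) F e =
    \sum_(e <- ranking adj (rank_of v) ord) F e.
  by rewrite [RHS](partition_big p xpredT).
rewrite !sumE.
rewrite -big_split /= (eq_bigr (fun=> 1)) => [|e _]; last by rewrite subrK.
by rewrite big_const_seq count_predT iter_addr_0.
Qed.

Lemma seller_gain_ge e v : e \in ranking adj (rank_of v) ord ->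
  weight (v e.2) <= seller_gain e.2 v.
Proof.
move=> eM; rewrite /seller_gain (big_rem e)//= eqxx lerDl.
by apply: sumr_ge0 => f _; exact: weight_ge0.
Qed.

Lemma buyer_gain_ge e v : e \in ranking adj (rank_of v) ord ->
  1 - weight (v e.2) <= buyer_gain e.1 v.
Proof.
move=> eM; rewrite /buyer_gain (big_rem e)//= eqxx lerDl.
by apply: sumr_ge0 => f _.
Qed.

(* The averaged sum telescopes by [sum_weight], whatever the threshold [k]. *)
Lemma avg_threshold_ge j v k (f : V -> R) : (k <= m.+1)%N ->
  (forall a, 1 - weight k + (if (a < k)%N then weight a else 0) <=
             f (upd v j a)) ->
  1 - weight 0 <= avg j f v.
Proof.
move=> kN fk; pose h (u : V) : R := 1 - weight k + 1 * (if (u j < k)%N then weight (u j) else 0).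
apply: (@le_trans _ _ (avg j h v)); last first.
  by apply: ler_avg => // a; rewrite /h mul1r ffunE eqxx.
rewrite avg_affine// mul1r /avg card_ord.
under eq_bigr do rewrite ffunE eqxx.
by rewrite -big_mkcond -(big_ord_widen m.+1 weight kN) sum_weight; lra.
Qed.

(** Compare with the run [M'] without [j]. If it gives [i] a partner of rank [k], monotonicity
    always secures [1 - weight k] for [i], and [j] is matched whenever its rank is below [k]. If [i]
    is unmatched in [M'], then [j] is always matched. *)
Lemma avg_gain_ge i j : adj i j -> i \in ord -> forall v,
  1 - weight 0 <= avg j (fun v => buyer_gain i v + seller_gain j v) v.
Proof.
move=> ij iord v; have j0 : j \notin finset.set0 by rewrite inE.
pose M' := ranking_aux adj (rank_of v) ord [set j].
have M'E a : ranking_aux adj (rank_of (upd v j a)) ord (j |: finset.set0) = M'.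
  by rewrite finset.setU0 ranking_deleted_upd.
have matchedP u : (exists2 e, e \in ranking adj (rank_of u) ord & e.2 = j) \/
    (forall e, e \in ranking adj (rank_of u) ord -> e.2 != j).
  have [/hasP[e eM /eqP]|nj] := boolP (has (fun e => e.2 == j) (ranking adj (rank_of u) ord)).
    by left; exists e.
  by right; exact/hasPn.
(* If [j] stays unmatched, the run equals [M'], and [i] found [j] free on arrival. *)
have unmatched u a : u = upd v j a ->
    (forall e, e \in ranking adj (rank_of u) ord -> e.2 != j) ->
    exists2 l, (i, l) \in M' & rank_of u l <= a%:R.
  move=> ->; rewrite /ranking => /[dup] nj /(ranking_aux_unmatched j0).
  rewrite M'E => ->.
  by have := ranking_aux_adj j0 ij iord nj; rewrite {3}/rank_of ffunE eqxx.
have [/hasP[[i' j1] j1M' /= /eqP i'i]|nM'] := boolP (has (fun e => e.1 == i) M').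
  rewrite {}i'i in j1M'.
  (* Taking the least-ranked partner of [i] in the list [M'] avoids proving that the partner is
     unique. *)
  have [j' /= j'M' j'min] :=
    @arg_minnP _ j1 (fun l => (i, l) \in M') (fun l => val (v l)) j1M'.
  have j'j : j' != j by have := ranking_aux_notin j'M'; rewrite inE.
  apply: (@avg_threshold_ge j v (v j')) => [|a]; first exact: ltnW.
  apply: lerD.
    have := j'M'; rewrite -(M'E a) => /(ranking_aux_setU1_le j0)[l lM].
    rewrite (rank_of_upd _ _ j'j) /rank_of ler_nat => lj'.
    by apply: le_trans (buyer_gain_ge lM); rewrite lerD2l lerN2 ler_weight.
  case: ifPn => [aj'|_]; last exact: seller_gain_ge0.
  have [[e eM ej]|nj] := matchedP (upd v j a).
    by have := seller_gain_ge eM; rewrite ej ffunE eqxx.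
  have [l ilM' la] := unmatched _ _ erefl nj.
  have lj : l != j by have := ranking_aux_notin ilM'; rewrite inE.
  move: la; rewrite (rank_of_upd _ _ lj) ler_nat => la.
  by have := leq_ltn_trans (leq_trans (j'min l ilM') la) aj'; rewrite ltnn.
(* At the threshold [m.+1] the buyer's share [1 - weight k] vanishes and every rank lies below. *)
apply: (@avg_threshold_ge j v m.+1) => // a.
rewrite weight_max subrr add0r ltn_ord -[leLHS]add0r lerD ?buyer_gain_ge0//.
have [[e eM ej]|nj] := matchedP (upd v j a).
  by have := seller_gain_ge eM; rewrite ej ffunE eqxx.
have [l ilM' _] := unmatched _ _ erefl nj.
by move/hasPn: nM' => /(_ _ ilM'); rewrite eqxx.
Qed.

(** The edges of [M] have distinct endpoints, so their gains add up to at most the total gain. Each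
    edge contributes at least [1 - weight 0] once its own seller's rank is averaged. *)
Lemma avgs_matching_size_ge (M : {set B * S}) v : is_matching adj M ->
  {subset enum B <= ord} ->
  (1 - weight 0) * #|M|%:R <= avgs (enum (snd @: M)) matching_size v.
Proof.
move=> [Madj Minj] Bord.
have inj1 : {in M &, injective (@fst B S)}.
  by move=> e f eM fM ef; apply: Minj; rewrite ?ef ?eqxx.
have inj2 : {in M &, injective (@snd B S)}.
  by move=> e f eM fM ef; apply: Minj; rewrite ?ef ?eqxx ?orbT.
pose h e u := buyer_gain e.1 u + seller_gain e.2 u.
apply: (@le_trans _ _ (avgs (enum (snd @: M)) (fun u => \sum_(e in M) h e u) v)).
  rewrite avgs_sum mulr_natr -sumr_const; apply: ler_sum => e eM.
  apply: (@avgs_ge _ _ _ K0 _ e.2); first by rewrite mem_enum imset_f.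
  by apply: avg_gain_ge; [exact: Madj|rewrite Bord ?mem_enum].
apply: ler_avgs => // u; rewrite -sum_gains /h big_split /=.
rewrite -(big_imset (fun i => buyer_gain i u) inj1).
rewrite -(big_imset (fun j => seller_gain j u) inj2).
apply: lerD.
  rewrite [leRHS](bigID (mem (fst @: M))) /= lerDl sumr_ge0// => i _.
  exact: buyer_gain_ge0.
rewrite [leRHS](bigID (mem (snd @: M))) /= lerDl sumr_ge0// => j _.
exact: seller_gain_ge0.
Qed.

(** Chernoff's bound, averaging first over the sellers of [M] only: the resulting estimate is
    uniform in the other ranks, so the variance term involves [#|M|] rather than [#|S|]. *)
Lemma mean_matching_size_le (M : {set B * S}) (s c : R) : is_matching adj M ->
  {subset enum B <= ord} -> 0 <= s ->
  mean (fun v => (matching_size v <= c)%R%:R : R) <=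
  expR (s * c - s * ((1 - weight 0) * #|M|%:R) + s ^+ 2 / 8 * #|M|%:R).
Proof.
move=> MM Bord s0; pose J := enum (snd @: M).
have sizeJ : size J = #|M|.
  rewrite /J -cardE card_in_imset// => e f eM fM ef.
  by apply: MM.2; rewrite ?ef ?eqxx ?orbT.
rewrite -addrA expRD.
apply: (@le_trans _ _ (mean (fun v : V => expR (s * c) * expR (- s * matching_size v)))).
  apply: ler_mean => v; case: (leP (matching_size v) c) => [fc|_]; last first.
    by rewrite mulr0n mulr_ge0 ?expR_ge0.
  by rewrite -expRD -[leLHS]expR0 ler_expR mulNr -mulrBr mulr_ge0// subr_ge0.
rewrite meanZl ler_wpM2l ?expR_ge0// -(mean_avgs K0 J) -[leRHS](mean_cst (K := 'I_m.+1) (S := S) K0).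
apply: ler_mean => v; apply: (le_trans (mcdiarmid_avgs K0 _ s0 v)).
  by move=> j _; exact: oscillates1_matching_size.
rewrite sizeJ ler_expR lerD2r mulNr lerN2 ler_wpM2l//.
exact: avgs_matching_size_ge.
Qed.

End DiscreteRanking.

(** * Discretisation of the ranks *)

Section FiniteUnions.
Context {T : Type} {I : finType}.
Implicit Types (p : pred I) (F : I -> set T).

Lemma in_bigsetU p F t :
  (\big[setU/set0]_(i | p i) F i) t <-> exists2 i, p i & F i t.
Proof.
rewrite -bigcup_seq_cond; split=> [[i /= /andP[_ pi] Fit]|[i pi Fit]].
  by exists i.
by exists i => //=; rewrite mem_index_enum.
Qed.

Lemma in_bigsetI p F t :
  (\big[setI/setT]_(i | p i) F i) t <-> forall i, p i -> F i t.
Proof.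
rewrite -bigcap_seq_cond; split=> [Ft i pi|Ft i /= /andP[_ pi]]; last exact: Ft.
by apply: Ft => /=; rewrite mem_index_enum.
Qed.

End FiniteUnions.

Lemma measure_bigsetU_le (d : measure_display) (T : measurableType d)
    (R : realType) (mu : {measure set T -> \bar R}) (I : Type) (r : seq I)
    (p : pred I) (F : I -> set T) : (forall i, measurable (F i)) ->
  (mu (\big[setU/set0]_(i <- r | p i) F i) <= \sum_(i <- r | p i) mu (F i))%E.
Proof.
move=> mF; elim: r => [|i r IH]; first by rewrite !big_nil measure0.
rewrite !big_cons; case: ifP => // _.
apply: (le_trans (measureU2 mu (mF i) (bigsetU_measurable _ _))) => //.
by rewrite leeD2l.
Qed.

Section Collisions.
Context {S : finType} {R : realType} (m : nat).
Local Notation V := {ffun S -> 'I_m.+1}.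

(** Union bound over ordered pairs of distinct sellers: with the rank of [j] fixed, exactly one
    value of the rank of [i] collides. *)
Lemma mean_not_injective :
  mean (fun v : V => (~~ injectiveb v)%:R : R) <= (#|S| ^ 2)%:R / m.+1%:R.
Proof.
have K0 : (0 < #|'I_m.+1|)%N by rewrite card_ord.
pose P (q : S * S) := q.1 != q.2.
apply: (@le_trans _ _ (mean (fun v : V => \sum_(q | P q) (v q.1 == v q.2)%:R : R))).
  apply: ler_mean => v; case: injectiveP => [_|/injectiveP/injectivePn].
    by apply: sumr_ge0.
  move=> [i [j ij vij]]; rewrite (bigD1 (i, j)) //= vij eqxx lerDl.
  by apply: sumr_ge0.
rewrite mean_sum mulr_natl; apply: (@le_trans _ _ (\sum_(q : S * S | P q) m.+1%:R^-1)).
  apply: ler_sum => -[i j]; rewrite /P /= eq_sym => /negbTE ji.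
  rewrite -(mean_avg K0 i) -[leRHS](mean_cst (S := S) K0); apply: ler_mean => v.
  rewrite /avg card_ord ler_piMl ?invr_ge0//.
  rewrite (bigD1 (v j)) //= big1 => [|a av]; rewrite !ffunE eqxx ji.
    by rewrite addr0 lern1 leq_b1.
  by rewrite (negbTE av).
rewrite sumr_const; apply: ler_wpMn2l; first by rewrite invr_ge0.
by rewrite -mulnn -card_prod max_card.
Qed.

End Collisions.

Section Discretisation.
Context {R : realType} {d : measure_display} {T : measurableType d}.
Context {S : finType} (P : probability T R) (x : S -> T -> R).
Hypotheses (xm : ranks_measurable x) (xu : ranks_uniform01 P x).
Hypothesis xi : ranks_independent P x.

Definition comparisons (w : T) : {ffun S * S -> bool} :=
  [ffun q => x q.1 w <= x q.2 w].

(** Only finitely many comparison patterns exist, so [E] is a finite union of sets, each prescribing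
    all comparisons. *)
Lemma measurable_comparison_event (E : set T) :
  (forall w w', comparisons w = comparisons w' -> E w -> E w') -> measurable E.
Proof.
move=> Einv; pose C (r : {ffun S * S -> bool}) := \big[setI/setT]_(q : S * S)
  (setT `&` (fun w => x q.1 w <= x q.2 w) @^-1` [set r q]).
have CP r w : C r w <-> comparisons w = r.
  rewrite /C in_bigsetI; split=> [H|<- q _]; last by rewrite ffunE.
  by apply/ffunP => q; rewrite ffunE; have [] := H q isT.
have -> : E = \big[setU/set0]_(r | `[< exists2 w, E w & comparisons w = r >]) C r.
  apply/seteqP; split=> w.
    by move=> Ew; apply/in_bigsetU; exists (comparisons w); [apply/asboolP; exists w|apply/CP].
  by move=> /in_bigsetU[r /asboolP[w' Ew' <-]] /CP /esym /Einv; apply.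
apply: bigsetU_measurable => r _; apply: bigsetI_measurable => q _.
by apply: measurable_realfun.measurable_fun_ler.
Qed.

Context (m : nat).
Local Notation V := {ffun S -> 'I_m.+1}.
Local Notation N := (m.+1%:R : R).

Let N0 : 0 < N. Proof. by rewrite ltr0n. Qed.

Definition cell_itv (k : nat) : set R := `[k%:R / N, k.+1%:R / N[.

Definition cell (v : V) : set T :=
  \big[setI/setT]_(j in [set: S]%SET) (x j @^-1` cell_itv (v j)).

Let measurable_preimage j (A : set R) : measurable A -> measurable (x j @^-1` A).
Proof. by move=> mA; rewrite -[X in measurable X]setTI; exact: xm. Qed.

Lemma measurable_cell v : measurable (cell v).
Proof.
apply: bigsetI_measurable => j _; apply: measurable_preimage.
exact: measurable_itv.
Qed.

Lemma prob_cell v : P (cell v) = ((#|V|%:R)^-1)%:E.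
Proof.
rewrite /cell xi; last by move=> j; exact: measurable_itv.
rewrite (eq_bigr (fun=> N^-1%:E)) => [|j _].
  rewrite prodEFin prodr_const cardsT exprVn card_ffun card_ord natrX.
  by [].
rewrite xu; last exact: measurable_itv.
have -> : cell_itv (v j) `&` `[0, 1] = cell_itv (v j).
  apply/setIidPl => y; rewrite /cell_itv /= !in_itv /= => /andP[y1 y2].
  rewrite (le_trans _ y1) ?divr_ge0//= ltW// (lt_le_trans y2)//.
  by rewrite ler_pdivrMr// mul1r ler_nat.
rewrite lebesgue_measure_itv /= lte_fin.
rewrite ltr_pM2r ?invr_gt0// ltr_nat ltnSn -EFinD -mulrBl -natrB//.
by rewrite subSnn mul1r.
Qed.

(** The half-open cells miss rank 1, but the complement of [[0, 1[] meets [[0, 1]] in that single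
    point. *)
Lemma prob_outside : P (\big[setU/set0]_j (x j @^-1` (~` `[0, 1[))) = 0%E.
Proof.
apply/eqP; rewrite eq_le measure_ge0 andbT.
apply: (le_trans (measure_bigsetU_le _ _ _ _)).
  by move=> j; apply: measurable_preimage; apply: measurableC; exact: measurable_itv.
rewrite big1// => j _; apply: (etrans (xu _ _)); first by apply: measurableC; exact: measurable_itv.
rewrite (_ : _ `&` _ = [set 1]) ?lebesgue_measure_set1//.
apply/seteqP; split=> y /=; rewrite !in_itv /=.
  move=> [] /negP; rewrite negb_and => + /andP[y0 y1].
  rewrite y0 /= -leNgt => y1'; apply/eqP; by rewrite eq_le y1 y1'.
by move=> ->; rewrite ltxx ler01 lexx; split.
Qed.

(** Off a null set, each sample lies in the cell of its truncated ranks; the bad cells are then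
    summed, each of mass [1 / #|V|]. *)
Lemma prob_le_mean (E : set T) (bad : pred V) : measurable E ->
  (forall w v, E w -> cell v w -> bad v) ->
  (P E <= (mean (fun v => (bad v)%:R))%:E)%E.
Proof.
move=> mE Ebad.
pose U := \big[setU/set0]_(v | bad v) cell v.
pose O := \big[setU/set0]_j (x j @^-1` (~` `[0, 1[)).
have mU : measurable U.
  by apply: bigsetU_measurable => v _; exact: measurable_cell.
have mO : measurable O.
  apply: bigsetU_measurable => j _; apply: measurable_preimage.
  by apply: measurableC; exact: measurable_itv.
have EUO : E `<=` U `|` O.
  move=> w Ew; have [Ow|Ow] := pselect (O w); [by right|left].
  have x01 j : 0 <= x j w < 1.
    apply/negPn/negP => nx; apply: Ow; apply/in_bigsetU; exists j => //=.
    by rewrite in_itv /=; exact/negP.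
  have kN j : (Num.trunc (x j w * N) < m.+1)%N.
    rewrite -(ltr_nat R); have /andP[x0 x1] := x01 j.
    apply: (@le_lt_trans _ _ (x j w * N)); first by rewrite truncn_le mulr_ge0// ltW.
    by rewrite -[ltRHS]mul1r ltr_pM2r.
  apply/in_bigsetU; exists [ffun j => Ordinal (kN j)]; last first.
    apply/in_bigsetI => j _; rewrite /cell_itv /= in_itv /= ffunE /=.
    have /andP[x0 x1] := x01 j.
    rewrite ler_pdivrMr// ltr_pdivlMr//.
    by apply: truncn_itv; rewrite mulr_ge0// ltW.
  apply: (Ebad w) => //; apply/in_bigsetI => j _; rewrite /cell_itv /= in_itv /= ffunE /=.
  have /andP[x0 x1] := x01 j.
  rewrite ler_pdivrMr// ltr_pdivlMr//.
  by apply: truncn_itv; rewrite mulr_ge0// ltW.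
apply: (le_trans (le_measure P _ _ EUO)); rewrite ?inE//; first exact: measurableU.
apply: (le_trans (measureU2 P mU mO)).
rewrite [X in (_ + X)%E](_ : _ = 0%E); last exact: prob_outside.
rewrite adde0.
apply: (le_trans (measure_bigsetU_le _ _ _ measurable_cell)).
rewrite (eq_bigr (fun=> ((#|V|%:R)^-1)%:E)) => [|v _]; last exact: prob_cell.
rewrite sumEFin lee_fin /mean mulr_suml.
by rewrite big_mkcond /=; apply: ler_sum => v _; case: (bad v); rewrite ?mul1r ?mul0r.
Qed.

(** Injectivity puts distinct sellers in disjoint intervals, ordered as their indices. *)
Lemma cell_comparisons w v : cell v w -> injective v ->
  forall j k, (x j w <= x k w) = (rank_of v j <= rank_of v k :> R).
Proof.
move=> /in_bigsetI wv vinj j k.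
have wvj l : (v l)%:R / N <= x l w < (v l).+1%:R / N.
  by have := wv l (finset.in_setT l); rewrite /cell_itv /= in_itv.
have lt_rank l l' : (v l < v l')%N -> x l w < x l' w.
  move=> ll'; have /andP[_ h1] := wvj l; have /andP[h2 _] := wvj l'.
  apply: (lt_le_trans h1); apply: le_trans h2.
  by rewrite ler_pM2r ?invr_gt0// ler_nat.
rewrite /rank_of ler_nat; have [jk|kj|/val_inj/vinj ->] := ltngtP (v j) (v k).
- by rewrite ltW// lt_rank.
- by apply/negbTE; rewrite -ltNge lt_rank.
- by rewrite lexx.
Qed.

End Discretisation.

(** * The tail bound *)

Lemma weight0_le (R : realType) (m : nat) :
  weight m 0 <= expR (-1) + m.+1%:R^-1 :> R.
Proof.
have [N NE] : exists N : R, N = m.+1%:R by exists m.+1%:R.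
rewrite /weight -NE; have N0 : 0 < N by rewrite NE ltr0n.
(* Chosen so that [(1 - u)^-1 = 1 + N^-1] and [N * u = 1 - u]: the first bounds [expR u], and the
   [N]-th power then gives [expR (-1 + u)]. *)
pose u : R := (N + 1)^-1.
have u_le : expR u <= 1 + N^-1.
  have -> : 1 + N^-1 = (1 - u)^-1.
    have -> : 1 - u = N / (N + 1).
      by rewrite /u; field; rewrite gt_eqF ?addr_gt0.
    by rewrite invf_div mulrDl divff ?gt_eqF// mul1r.
  have u1 : 0 < 1 - u by rewrite subr_gt0 invf_lt1 ?addr_gt0// ltrDr.
  rewrite -[expR u]invrK -expRN lef_pV2 ?posrE ?expR_gt0//.
  exact: expR_ge1Dx.
have q0 : 0 < 1 + N^-1 by rewrite addr_gt0// invr_gt0.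
rewrite expr0 div1r.
apply: (@le_trans _ _ (expR (-1) * (1 + N^-1))).
  apply: (@le_trans _ _ (expR (- (N * u)))).
    rewrite expRN lef_pV2 ?posrE ?exprn_gt0 ?expR_gt0//.
    by rewrite {1}NE expRM_natl lerXn2r ?nnegrE ?expR_ge0// ltW.
  have -> : - (N * u) = -1 + u by rewrite /u; field; rewrite gt_eqF ?addr_gt0.
  by rewrite expRD ler_wpM2l ?expR_ge0.
by rewrite mulrDr mulr1 lerD2l ler_piMl ?invr_ge0 ?ltW//.
Qed.

(** A discrete outcome is bad if two ranks collide, which gives the first term, or if its own
    matching is small, which gives the second. *)
Lemma prob_ranking_size_le (R : realType) (d : measure_display)
  (T : measurableType d) (P : probability T R) (S B : finType)
  (adj : B -> S -> bool) (x : S -> T -> R) (n : nat) (ord : seq B)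
  (c s : R) (m : nat) :
  ranks_measurable x -> ranks_uniform01 P x -> ranks_independent P x ->
  admits_matching_of_size adj n -> arrival_order ord -> 0 <= s ->
  (P [set w | ((ranking_size adj (fun j => x j w) ord)%:R <= c)%R]
    <= ((#|S| ^ 2)%:R / m.+1%:R +
        expR (s * c - s * ((1 - weight m 0) * n%:R) + s ^+ 2 / 8 * n%:R))%R%:E)%E.
Proof.
move=> xm xu xi [M [MM Mn]] ordB s0.
have Bord : {subset enum B <= ord} by move=> i; rewrite (perm_mem ordB).
pose bad (v : {ffun S -> 'I_m.+1}) :=
  ~~ injectiveb v || (matching_size adj ord v <= c).
apply: (le_trans (prob_le_mean xm xu xi (bad := bad) _ _)).
- apply: measurable_comparison_event => // w w' ww' /=.
  rewrite /ranking_size /ranking (@ranking_aux_cmp _ _ adj _ (x^~ w) (x^~ w'))//.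
  by move=> j k _ _; have /ffunP/(_ (j, k)) := ww'; rewrite !ffunE.
- move=> w v /= wc vw; rewrite /bad -implybE; apply/implyP => /injectiveP vinj.
  rewrite /matching_size /ranking_size /ranking.
  rewrite (@ranking_aux_cmp _ _ adj _ _ (x^~ w))// => j k _ _.
  by rewrite (cell_comparisons vw vinj).
rewrite lee_fin.
apply: (@le_trans _ _ (mean (fun v : {ffun S -> 'I_m.+1} =>
    (~~ injectiveb v)%:R + (matching_size adj ord v <= c)%R%:R : R))).
  apply: ler_mean => v; rewrite /bad.
  by case: (injectiveb v); case: (matching_size _ _ _ <= c)%R; rewrite /= ?lerr ?addr0 ?add0r ?lerDl.
rewrite /mean big_split mulrDl; apply: lerD; first exact: mean_not_injective.
by rewrite -Mn; apply: mean_matching_size_le.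
Qed.

Lemma largest_nat_below (R : realType) (y : R) : 0 < y ->
  exists2 k : nat, k%:R < y & forall l : nat, l%:R < y -> l%:R <= k%:R :> R.
Proof.
move=> y0; have ub l : l%:R < y -> (l <= Num.trunc y)%N.
  by move=> ly; rewrite truncn_ge_nat ltW.
have [k ky kmax] := ex_maxnP (ex_intro (fun l : nat => l%:R < y) 0%N y0) ub.
by exists k => // l /kmax; rewrite ler_nat.
Qed.

Unset Implicit Arguments.

Theorem theorem1 (R : realType) (d : measure_display) (T : measurableType d)
  (P : probability T R) (S B : finType) (adj : B -> S -> bool)
  (x : S -> T -> R) (n : nat) (alpha : R) (ord : seq B) :
  ranks_measurable x ->
  ranks_uniform01 P x ->
  ranks_independent P x ->
  admits_matching_of_size adj n ->
  0 < alpha ->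
  arrival_order ord ->
  (P [set w | ((ranking_size adj (fun j => x j w) ord)%:R
                 < (1 - expR (-1) - alpha) * n%:R)%R]
   < (expR (- (2 * alpha ^+ 2 * n%:R)%R))%:E)%E.
Proof.
move=> xm xu xi Gn alpha0 ordB; set E := [set w | _].
pose y : R := (1 - expR (-1) - alpha) * n%:R.
(* A nonpositive threshold, as for [n = 0], makes the event empty. *)
have [y0|y0] := leP y 0.
  have -> : E = set0.
    by apply/seteqP; split=> // w; rewrite /E /= ltNge (le_trans y0).
  by rewrite measure0 lte_fin expR_gt0.
have n0 : 0 < n%:R :> R.
  by rewrite lt0r ler0n andbT; apply: contraTneq y0 => n0; rewrite /y n0 mulr0 ltxx.
(* [|M|] is an integer, so [E] is the event of a deviation [beta > alpha]. *)
have [k ky kmax] := largest_nat_below y0.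
pose beta : R := 1 - expR (-1) - k%:R / n%:R.
have kE : k%:R = (1 - expR (-1) - beta) * n%:R.
  by rewrite /beta opprB addrC subrK divfK ?gt_eqF.
have ab : alpha < beta by rewrite -subr_gt0 -(pmulr_lgt0 _ n0); rewrite /y kE in ky; lra.
have Ek : E = [set w | (ranking_size adj (fun j => x j w) ord)%:R <= k%:R :> R].
  apply/seteqP; split=> w; rewrite /E /=; first exact: kmax.
  by move=> /le_lt_trans; apply.
(* The exponent for [beta] beats the target by twice [gap]: one [gap] absorbs the error of
   [weight m 0] against [expR (-1)], the other leaves [slack] for collisions. *)
pose gap : R := (beta ^+ 2 - alpha ^+ 2) * n%:R.
have gap0 : 0 < gap by rewrite mulr_gt0// subr_gt0 ltrXn2r ?nnegrE ?ltW// (lt_trans alpha0).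
pose slack : R := expR (- (2 * alpha ^+ 2 * n%:R)) - expR (- (2 * alpha ^+ 2 * n%:R) - gap).
have slack0 : 0 < slack by rewrite subr_gt0 ltr_expR ltrBlDr ltrDl.
(* The two summands make [4 * beta * n / N] at most [gap] and [#|S| ^ 2 / N] less than [slack]. *)
pose bound : R := 4 * beta * n%:R / gap + (#|S| ^ 2)%:R / slack.
have [m Hm] : exists m : nat, bound < m.+1%:R.
  by exists (Num.trunc bound); rewrite truncnS_gt.
set N : R := m.+1%:R in Hm; have N0 : 0 < N by rewrite ltr0n.
have beta0 := lt_trans alpha0 ab.
(* The Chernoff parameter [4 * beta] minimises [- s * beta * n + s ^+ 2 / 8 * n], with minimum
   [- 2 * beta ^+ 2 * n]. *)
have s0 : 0 <= 4 * beta by rewrite mulr_ge0// ltW.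
have t1 : 0 <= 4 * beta * n%:R / gap.
  by apply: divr_ge0 (ltW gap0); exact: mulr_ge0 s0 (ltW n0).
have t2 : 0 <= (#|S| ^ 2)%:R / slack by exact: divr_ge0 (ler0n _ _) (ltW slack0).
have h1 : 4 * beta * n%:R / N <= gap.
  rewrite ler_pdivrMr// (mulrC gap) -ler_pdivrMr//; apply: ltW; apply: le_lt_trans Hm.
  by rewrite /bound lerDl.
have h2 : (#|S| ^ 2)%:R / N < slack.
  rewrite ltr_pdivrMr// (mulrC slack) -ltr_pdivrMr//; apply: le_lt_trans Hm.
  by rewrite /bound lerDr.
rewrite Ek; apply: (le_lt_trans
  (@prob_ranking_size_le _ _ _ _ _ _ _ _ _ _ k%:R _ m xm xu xi Gn ordB s0)).
rewrite lte_fin -/N.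
apply: (@lt_le_trans _ _ (slack + expR (- (2 * alpha ^+ 2 * n%:R) - gap))); last by rewrite /slack subrK.
apply: ltr_leD => //; rewrite ler_expR.
have w0 : 4 * beta * n%:R * weight m 0 <= 4 * beta * n%:R * (expR (-1) + N^-1).
  by rewrite ler_wpM2l ?weight0_le// mulr_ge0// ltW.
rewrite kE; set e : R := expR (-1) in w0 *; set w : R := weight m 0 in w0 *.
have -> : 4 * beta * ((1 - e - beta) * n%:R) - 4 * beta * ((1 - w) * n%:R) +
    (4 * beta) ^+ 2 / 8 * n%:R =
    4 * beta * n%:R * w - 4 * beta * n%:R * e - 2 * (beta ^+ 2 * n%:R) by field.
have -> : - (2 * alpha ^+ 2 * n%:R) - gap =
    gap - 2 * (beta ^+ 2 * n%:R) by rewrite /gap; ring.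
by rewrite lerD2r lerBlDl; apply: (le_trans w0); rewrite mulrDr lerD2l.
Qed.
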